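(* Let $\mathcal X,\mathcal Y_1,\mathcal Y_2,\mathcal W$ be finite nonempty sets and $g:\mathcal W\times\mathcal X\to[0,1]$ a gain function. For any prior $\pi$ on $\mathcal X$ with $V_g(\pi)>0$ and any two channels $(\mathcal X,\mathcal Y_1,C_1)$ and $(\mathcal X,\mathcal Y_2,C_2)$, $$H_g(\pi,C_1\parallel C_2)\ \ge\ H_g(\pi,C_1)+H_g(\pi,C_2)-H_g^{\min}(\pi).$$
   Context: A (discrete) channel $(\mathcal X,\mathcal Y,C)$ consists of finite sets $\mathcal X,\mathcal Y$ and a matrix $C$ with entries $C[x,y]\ge 0$ and $\sum_{y}C[x,y]=1$ for each $x$. A prior on $\mathcal X$ is a probability distribution on $\mathcal X$. The parallel composition with shared input $C_1\parallel C_2$ is the channel from $\mathcal X$ to $\mathcal Y_1\times\mathcal Y_2$ with $(C_1\parallel C_2)[x,(y_1,y_2)]=C_1[x,y_1]\,C_2[x,y_2]$. $V_g(\pi)=\max_{w\in\mathcal W}\sum_{x}\pi[x]g(w,x)$, $V_g(\pi,C)=\sum_{y}\max_{w\in\mathcal W}\sum_x\pi[x]C[x,y]g(w,x)$, and $H_g(\pi,C)=-\log V_g(\pi,C)$. Logarithms are to base 2. $H_g^{\min}(\pi)=-\log\min\{\pi[x]g(w,x): x\in\mathcal X,\ w\in\mathcal W,\ \pi[x]g(w,x)\ne0\}$. *)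

(* Defs.v *)
From HB Require Import structures.
From mathcomp Require Import all_boot all_order all_algebra.
From mathcomp Require Import reals exp.

Set Implicit Arguments.
Unset Strict Implicit.
Unset Printing Implicit Defensive.

Import Order.TTheory GRing.Theory Num.Theory.
Local Open Scope ring_scope.

Record channel (R : realType) (X Y : finType) := Channel {
  channel_fun :> X -> Y -> R;
  channel_ge0 : forall x y, 0 <= channel_fun x y;
  channel_sum1 : forall x, \sum_(y : Y) channel_fun x y = 1 }.

Record prior (R : realType) (X : finType) := Prior {
  prior_fun :> X -> R;
  prior_ge0 : forall x, 0 <= prior_fun x;
  prior_sum1 : \sum_(x : X) prior_fun x = 1 }.

Record gain (R : realType) (W X : finType) := Gain {
  gain_fun :> W -> X -> R;
  gain_ge0 : forall w x, 0 <= gain_fun w x;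
  gain_le1 : forall w x, gain_fun w x <= 1 }.

Section Parallel.
Variables (R : realType) (X Y1 Y2 : finType).
Variables (C1 : channel R X Y1) (C2 : channel R X Y2).

Definition parallel_fun (x : X) (y : Y1 * Y2) : R := C1 x y.1 * C2 x y.2.

Lemma parallel_ge0 x y : 0 <= parallel_fun x y.
Proof. by rewrite mulr_ge0 ?channel_ge0. Qed.

Lemma parallel_sum1 x : \sum_(y : Y1 * Y2) parallel_fun x y = 1.
Proof.
rewrite -(pair_bigA _ (fun y1 y2 => C1 x y1 * C2 x y2)) /=.
rewrite -(channel_sum1 C1 x); apply: eq_bigr => y1 _.
by rewrite -mulr_sumr channel_sum1 mulr1.
Qed.

Definition parallel : channel R X (Y1 * Y2)%type :=
  Channel parallel_ge0 parallel_sum1.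

End Parallel.

Section Vulnerability.
Variables (R : realType) (W X : finType) (g : gain R W X) (p : prior R X).

Definition log2 (x : R) : R := ln x / ln 2.

(* The maximised quantities are nonnegative, so for nonempty W the base value 0
   does not affect the maxima (see prior_vulnerability_attained and
   posterior_vulnerability_attained). *)
Definition prior_vulnerability : R :=
  \big[Order.max/0]_(w : W) \sum_(x : X) p x * g w x.

Definition posterior_vulnerability (Y : finType) (C : channel R X Y) : R :=
  \sum_(y : Y) \big[Order.max/0]_(w : W) \sum_(x : X) p x * C x y * g w x.

Definition posterior_entropy (Y : finType) (C : channel R X Y) : R :=
  - log2 (posterior_vulnerability C).

(* All the products p x * g w x are at most 1, so when some product is nonzero
   the base value 1 does not affect the minimum (see min_gain_attained). *)
Definition min_gain : R :=
  \big[Order.min/1]_(u : X * W | p u.1 * g u.2 u.1 != 0) (p u.1 * g u.2 u.1).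

Definition min_entropy : R := - log2 min_gain.

Lemma prior_le1 x : p x <= 1.
Proof.
rewrite -(prior_sum1 p) (bigD1 x) //= lerDl.
by apply: sumr_ge0 => i _; exact: prior_ge0.
Qed.

Lemma bigmax0_attained (F : W -> R) : (0 < #|W|)%N -> (forall w, 0 <= F w) ->
  exists2 w, \big[Order.max/0]_(w : W) F w = F w & forall w', F w' <= F w.
Proof.
move=> /card_gt0P[w0 _] F0.
have [w _ Fw] := eq_bigmax w0 predT F isT (fun w _ => F0 w).
by exists w => // w'; rewrite -Fw; exact: le_bigmax.
Qed.

Lemma prior_vulnerability_attained : (0 < #|W|)%N ->
  exists2 w, prior_vulnerability = \sum_x p x * g w x &
    forall w', \sum_x p x * g w' x <= \sum_x p x * g w x.
Proof.
move=> W0; apply: (bigmax0_attained W0) => w.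
by apply: sumr_ge0 => x _; rewrite mulr_ge0 ?prior_ge0 ?gain_ge0.
Qed.

Lemma posterior_vulnerability_attained (Y : finType) (C : channel R X Y) y :
  (0 < #|W|)%N ->
  exists2 w, \big[Order.max/0]_(w : W) \sum_x p x * C x y * g w x =
             \sum_x p x * C x y * g w x &
    forall w', \sum_x p x * C x y * g w' x <= \sum_x p x * C x y * g w x.
Proof.
move=> W0; apply: (bigmax0_attained W0) => w; apply: sumr_ge0 => x _.
by rewrite !mulr_ge0 ?prior_ge0 ?gain_ge0 ?channel_ge0.
Qed.

Lemma min_gain_attained x0 w0 : p x0 * g w0 x0 != 0 ->
  exists x w, [/\ p x * g w x != 0, min_gain = p x * g w x &
    forall x' w', p x' * g w' x' != 0 -> p x * g w x <= p x' * g w' x'].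
Proof.
move=> h0; have le1 (u : X * W) : p u.1 * g u.2 u.1 <= 1.
  by rewrite mulr_ile1 ?prior_ge0 ?gain_ge0 ?prior_le1 ?gain_le1.
have [[x w] h Fu] := eq_bigmin (x0, w0) (fun u : X * W => p u.1 * g u.2 u.1 != 0)
  (fun u : X * W => p u.1 * g u.2 u.1) h0 (fun u _ => le1 u).
exists x, w; split => // x' w' h'.
by rewrite -[leLHS]Fu; exact: (bigmin_le_cond _ (j := (x', w'))).
Qed.

End Vulnerability.

(* Main.v *)
Require Import Defs.
From HB Require Import structures.
From mathcomp Require Import all_boot all_order all_algebra.
From mathcomp Require Import reals exp.
From mathcomp Require Import lra.
Import Order.TTheory GRing.Theory Num.Theory.
Local Open Scope ring_scope.

(** With [m] the least nonzero value of [p x * g w x] and [a x = p x * g w x] for a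
    fixed [w], one has
    [m * a x <= a x ^+ 2] for every [x].  Hence
    [m * \sum_x a x * C1 x y1 * C2 x y2 <=
      \sum_x (a x * C1 x y1) * (a x * C2 x y2) <=
      (\sum_x a x * C1 x y1) * (\sum_x a x * C2 x y2)],
    the last step because all terms are nonnegative.  Maximising over [w] and
    summing over the outputs bounds [m] times the vulnerability of the parallel
    composition by the product of the two vulnerabilities. *)

(** The left side is the diagonal of the expanded double sum. *)
Lemma sumr_mul_le (R : numDomainType) (I : finType) (a b : I -> R) :
  (forall i, 0 <= a i) -> (forall i, 0 <= b i) ->
  \sum_i a i * b i <= (\sum_i a i) * (\sum_i b i).
Proof.
move=> a0 b0; rewrite mulr_suml; apply: ler_sum => i _.
rewrite ler_wpM2l // (bigD1 i) //= lerDl.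
by apply: sumr_ge0 => j _.
Qed.

Section VulnerabilityBounds.
Context {R : realType} {W X : finType} {g : gain R W X} {p : prior R X}.

Lemma prior_gain_ge0 w x : 0 <= p x * g w x.
Proof. by rewrite mulr_ge0 ?prior_ge0 ?gain_ge0. Qed.

Lemma min_gain_gt0 : 0 < min_gain g p.
Proof.
rewrite /min_gain; apply: (big_ind (fun z : R => 0 < z)) => //.
- by move=> a b a0 b0; rewrite lt_min a0.
- by move=> u u0; rewrite lt_def u0 prior_gain_ge0.
Qed.

Lemma min_gain_mul_le w x :
  min_gain g p * (p x * g w x) <= (p x * g w x) * (p x * g w x).
Proof.
(* [min_gain] ranges over nonzero products only, so a zero product is treated apart. *)
have [->|h] := eqVneq (p x * g w x) 0; first by rewrite !mulr0.
rewrite ler_wpM2r ?prior_gain_ge0 //.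
exact: (bigmin_le_cond _ (j := (x, w))).
Qed.

(** Rows of [C] sum to 1, so the gain of a fixed [w] splits over the outputs, and choosing [w] anew
    for each output cannot lose. This makes the arguments of [ln] positive in the theorem. *)
Lemma prior_le_posterior_vulnerability (Y : finType) (C : channel R X Y) :
  prior_vulnerability g p <= posterior_vulnerability g p C.
Proof.
apply: bigmax_le => [|w _].
  by apply: sumr_ge0 => y _; exact: bigmax_ge_id.
have -> : \sum_x p x * g w x = \sum_y \sum_x p x * C x y * g w x.
  rewrite exchange_big; apply: eq_bigr => x _ /=.
  by rewrite -mulr_suml -mulr_sumr channel_sum1 mulr1.
apply: ler_sum => y _.
exact: (le_bigmax _ (fun w' => \sum_x p x * C x y * g w' x)).
Qed.

Lemma posterior_vulnerability_parallel_le (Y1 Y2 : finType)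
    (C1 : channel R X Y1) (C2 : channel R X Y2) :
  min_gain g p * posterior_vulnerability g p (parallel C1 C2) <=
    posterior_vulnerability g p C1 * posterior_vulnerability g p C2.
Proof.
rewrite /posterior_vulnerability mulr_sumr big_distrlr pair_bigA /=.
apply: ler_sum => -[y1 y2] _ /=.
(* Moving [min_gain] to the right isolates the maximum, so that each [w] can be bounded
   separately. *)
rewrite mulrC -ler_pdivlMr ?min_gain_gt0 //.
apply: bigmax_le => [|w _].
  by rewrite divr_ge0 ?mulr_ge0 ?(ltW min_gain_gt0) //; exact: bigmax_ge_id.
rewrite ler_pdivlMr ?min_gain_gt0 // mulr_suml.
have term_ge0 (Y : finType) (C : channel R X Y) y x : 0 <= p x * C x y * g w x.
  by rewrite !mulr_ge0 ?prior_ge0 ?gain_ge0 ?channel_ge0.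
(* The [w] chosen for the pair of outputs serves as a guess for each channel alone; each factor is
   then at most its own maximum. *)
apply: (@le_trans _ _
  ((\sum_x p x * C1 x y1 * g w x) * (\sum_x p x * C2 x y2 * g w x))).
  apply: le_trans (sumr_mul_le _ _ _ _ _ _) => //.
  apply: ler_sum => x _; rewrite /parallel_fun /=.
  have := ler_wpM2r (mulr_ge0 (channel_ge0 C1 x y1) (channel_ge0 C2 x y2))
    (min_gain_mul_le w x).
  by lra.
have le_max (Y : finType) (C : channel R X Y) y :
    \sum_x p x * C x y * g w x <=
    \big[Order.max/0]_w' \sum_x p x * C x y * g w' x.
  exact: (le_bigmax _ (fun w' => \sum_x p x * C x y * g w' x)).
by apply: ler_pM; rewrite ?le_max ?sumr_ge0.
Qed.

End VulnerabilityBounds.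

Theorem theorem3p12 (R : realType) (X Y1 Y2 W : finType)
    (hX : (0 < #|X|)%N) (hY1 : (0 < #|Y1|)%N) (hY2 : (0 < #|Y2|)%N)
    (hW : (0 < #|W|)%N)
    (g : gain R W X) (p : prior R X) (hV : 0 < prior_vulnerability g p)
    (C1 : channel R X Y1) (C2 : channel R X Y2) :
  posterior_entropy g p (parallel C1 C2) >=
    posterior_entropy g p C1 + posterior_entropy g p C2 - min_entropy g p.
Proof.
have V_gt0 (Y : finType) (C : channel R X Y) : 0 < posterior_vulnerability g p C.
  exact: lt_le_trans hV (prior_le_posterior_vulnerability Y C).
have m_gt0 : 0 < min_gain g p := min_gain_gt0.
have ln_le : ln (min_gain g p) + ln (posterior_vulnerability g p (parallel C1 C2))
    <= ln (posterior_vulnerability g p C1) + ln (posterior_vulnerability g p C2).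
  rewrite -!lnM ?posrE ?V_gt0 // ler_ln ?posrE ?mulr_gt0 ?V_gt0 //.
  exact: posterior_vulnerability_parallel_le.
have ln2_gt0 : 0 < ln (2 : R) by rewrite ln_gt0 // ltr1n.
have ln2V_ge0 : 0 <= (ln (2 : R))^-1 by rewrite invr_ge0 ltW.
(* Scaling by [(ln 2)^-1] passes to base 2; the minus signs of the entropies then reverse the
   inequality. *)
have := ler_wpM2r ln2V_ge0 ln_le.
rewrite /posterior_entropy /min_entropy /log2 !mulrDl.
by lra.
Qed.
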